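(* Let $X$ be a metric continuum. Then there exist a one-dimensional hereditarily indecomposable continuum $Y$ of countable weight (i.e.\ $Y$ is metrizable) and a continuous surjection $\pi:Y\to X$ that is weakly confluent.
   Context: A continuum is a compact connected Hausdorff space. A continuum is decomposable if it is the union of two proper subcontinua and indecomposable otherwise; it is hereditarily indecomposable if every subcontinuum is indecomposable (equivalently, of any two subcontinua that meet, one contains the other). A continuous surjection $\pi:Y\to X$ between continua is weakly confluent if every subcontinuum $K$ of $X$ is the image $\pi[K']$ of some subcontinuum $K'$ of $Y$. ''One-dimensional'' refers to covering dimension $1$. *)

(* Defs.v *)
From HB Require Import structures.
From mathcomp Require Import all_boot all_order all_algebra.
From mathcomp Require Import all_classical all_reals all_analysis.
Set Implicit Arguments. Unset Strict Implicit. Unset Printing Implicit Defensive.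
Import Order.TTheory GRing.Theory Num.Theory.
Local Open Scope classical_set_scope.

(* A continuum (as a subset of an ambient Hausdorff space): nonempty, compact,
   connected. *)
Definition is_continuum (T : topologicalType) (K : set T) : Prop :=
  K !=set0 /\ compact K /\ connected K.

Definition decomposable (T : topologicalType) (K : set T) : Prop :=
  exists A B : set T,
    [/\ is_continuum A, is_continuum B, A `<` K, B `<` K & K = A `|` B].

Definition hereditarily_indecomposable (T : topologicalType) : Prop :=
  forall K : set T, is_continuum K -> ~ decomposable K.

Definition covdim_le (T : topologicalType) (n : nat) : Prop :=
  forall (k : nat) (U : 'I_k -> set T),
    (forall i, open (U i)) -> (forall x : T, exists i, U i x) ->
    exists (m : nat) (V : 'I_m -> set T),
      [/\ (forall j, open (V j)),
          (forall x : T, exists j, V j x),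
          (forall j, exists i, V j `<=` U i) &
          (forall x : T, (#|[set j : 'I_m | `[< V j x >]]| <= n.+1)%N)].

Definition covdim_eq1 (T : topologicalType) : Prop :=
  covdim_le T 1 /\ ~ covdim_le T 0.

Definition weakly_confluent (S T : topologicalType) (f : S -> T) : Prop :=
  forall K : set T, is_continuum K ->
    exists K' : set S, is_continuum K' /\ f @` K' = K.

(* Main.v *)
Require Import Defs.
From HB Require Import structures.
From mathcomp Require Import all_boot all_order all_algebra.
From mathcomp Require Import all_classical all_reals all_analysis lra.
Set Implicit Arguments. Unset Strict Implicit. Unset Printing Implicit Defensive.
Import Order.TTheory GRing.Theory Num.Theory.
Import numFieldNormedType.Exports.
Local Open Scope classical_set_scope.
Local Open Scope ring_scope.

(** The space [Y] is a subset of [X * [0, 1]] times countably many blocks of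
    real coordinates, cut out by one closed condition per block. Over a point
    of what has been built so far, block [n] ranges over a finite graph whose
    vertices and edges are present over prescribed closed sets.

    - Cover steps. For a finite closed cover [F] take the complete graph on the
      [i] with [z \in F i]. The open stars of the vertices refine [F] and have
      order at most 2, which yields dimension at most 1.
    - Fold steps. For open [U], [V] with disjoint closures take three sheets
      over [~` V], [~` (U `|` V)], [~` U], the first two joined over the
      boundary of [V], the last two over that of [U]. Two meeting subcontinua,
      neither containing the other, cannot survive all such folds.

    Over each point of the base the number of selected vertices lying in a
    relatively clopen set has a parity that is locally constant, hence constant
    over a continuum. A closed set is odd over [K] if each of its neighbourhoods
    contains a clopen set of parity 1. By Zorn's lemma every odd closed set
    contains an odd continuum; an odd set projects onto [K]; and oddness over
    the whole base restricts to every subcontinuum [K]. The odd continuum over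
    the whole base is [Y]. The factor [[0, 1]] makes [Y] nondegenerate. *)

(** * Sequence spaces with a pseudometric for the product topology *)

Definition seqspace (T : Type) := nat -> T.

Section seqspace_pseudometric.
Context {R : realType} {T : pseudoMetricType R}.

(* The bound on the index makes every ball depend on finitely many
   coordinates only. *)
Definition seq_ball (u : seqspace T) (e : R) (v : seqspace T) :=
  0 < e /\ forall n, n%:R * e < 1 -> ball (u n) e (v n).

Lemma seq_ball_center u e : 0 < e -> seq_ball u e u.
Proof. by move=> e0; split=> // n _; exact: ballxx. Qed.

Lemma seq_ball_sym u v e : seq_ball u e v -> seq_ball v e u.
Proof. by move=> [e0 uv]; split=> // n ne; exact/ball_sym/uv. Qed.

Lemma seq_ball_triangle u v w e1 e2 :
  seq_ball u e1 v -> seq_ball v e2 w -> seq_ball u (e1 + e2) w.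
Proof.
move=> [e10 uv] [e20 vw]; split; first exact: addr_gt0.
move=> n; rewrite mulrDr => ne.
have p1 : 0 <= n%:R * e1 by rewrite mulr_ge0// ltW.
have p2 : 0 <= n%:R * e2 by rewrite mulr_ge0// ltW.
apply: (ball_triangle (uv n _) (vw n _)); apply: le_lt_trans ne.
  by rewrite lerDl.
by rewrite lerDr.
Qed.

HB.instance Definition _ := Choice.copy (seqspace T) (nat -> T).
HB.instance Definition _ :=
  hasNbhs.Build (seqspace T) (nbhs_ (entourage_ seq_ball)).
HB.instance Definition _ := @Nbhs_isPseudoMetric.Build R (seqspace T)
  (entourage_ seq_ball) erefl seq_ball
  seq_ball_center seq_ball_sym seq_ball_triangle erefl.

End seqspace_pseudometric.

Section seqspace_topology.
Context {R : realType} {T : pseudoMetricType R}.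

Lemma seqspace_proj_continuous n : continuous (fun u : seqspace T => u n).
Proof.
move=> u; apply/(@cvg_ballP _ _ _ (nbhs u)) => e e0.
(* The second bound gives [n%:R * d < 1], so that balls of radius [d] inspect coordinate [n]. *)
pose d := Num.min e (n.+1%:R^-1 / 2).
have d0 : 0 < d by rewrite lt_min e0/= divr_gt0// invr_gt0.
apply: filterS (nbhsx_ballx u d d0) => v [_ /(_ n) b].
apply: (@le_ball _ _ _ d); first by rewrite ge_min lexx.
apply: b; apply: (@le_lt_trans _ _ (n%:R * (n.+1%:R^-1))).
  rewrite ler_wpM2l// ge_min; apply/orP; right.
  by rewrite ler_pdivrMr// ler_peMr ?invr_ge0// ler1n.
by rewrite ltr_pdivrMr// mul1r ltr_nat.
Qed.

(** A ball of radius [e] constrains only the indices below [1 / e], so finitely many coordinate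
    conditions suffice. *)
Lemma continuous_seqspace (S : topologicalType) (f : S -> seqspace T) :
  (forall n, continuous (fun s => f s n)) -> continuous f.
Proof.
move=> cf s; apply/cvg_ballP => e e0.
have near_lt N : \forall t \near s, forall n, (n < N)%N -> ball (f s n) e (f t n).
  elim: N => [|N IH]; first by near=> t.
  have := cf N s => /cvg_ballP /(_ e e0) h.
  near=> t => n; rewrite ltnS leq_eqVlt => /orP[/eqP ->|].
    by near: t.
  by move: n; near: t.
near=> t; split=> // n ne.
have h : forall n, (n < (Num.truncn e^-1).+1)%N -> ball (f s n) e (f t n).
  by near: t; exact: near_lt.
apply: h; rewrite -(@ltr_nat R); apply: lt_trans (truncnS_gt _).
by rewrite -[e^-1]mul1r ltr_pdivlMr.
Unshelve. all: by end_near. Qed.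

Lemma seqspace_compact (A : set T) :
  compact A -> compact [set u : seqspace T | forall n, A (u n)].
Proof.
move=> cA.
pose P := [set f : prod_topology (fun _ : nat => T) | forall n, A (f n)].
have cP : compact P := @tychonoff nat (fun=> T) (fun=> A) (fun=> cA).
rewrite (_ : mkset _ =
  (fun f : prod_topology (fun=> T) => f : seqspace T) @` P); last first.
  by apply/seteqP; split=> [u Au|_ [u Au <-]] //; exists u.
apply: continuous_compact => //.
apply: continuous_subspaceT.
apply: continuous_seqspace => n.
exact: (@proj_continuous nat (fun=> T) n).
Qed.

End seqspace_topology.

Lemma cluster_continuous (S T : topologicalType) (f : S -> T) (p q : S) :
  continuous f -> cluster (nbhs p) q -> cluster (nbhs (f p)) (f q).
Proof.
move=> cf pq A B Ap Bq.
by have [z [Az Bz]] := pq _ _ (cf p A Ap) (cf q B Bq); exists (f z).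
Qed.

Lemma seqspace_hausdorff (R : realType) (T : pseudoMetricType R) :
  hausdorff_space T -> hausdorff_space (seqspace T).
Proof.
move=> hT p q pq; apply/funext => n; apply: hT.
exact: cluster_continuous (@seqspace_proj_continuous R T n) pq.
Qed.

Lemma prod_hausdorff (S T : topologicalType) :
  hausdorff_space S -> hausdorff_space T -> hausdorff_space (S * T)%type.
Proof.
move=> hS hT [p1 p2] [q1 q2] pq.
have c1 : continuous (@fst S T) by move=> z; exact: cvg_fst.
have c2 : continuous (@snd S T) by move=> z; exact: cvg_snd.
by congr pair; [apply: hS|apply: hT];
  [exact: cluster_continuous c1 pq|exact: cluster_continuous c2 pq].
Qed.

(** * Relatively clopen predicates *)

(** Relatively clopen subsets are coded by boolean functions so that they can be added mod 2. *)
Definition clopen_on (Z : topologicalType) (C : set Z) (q : Z -> bool) :=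
  forall b, closed (C `&` [set z | q z = b]).

Section clopen_on.
Context {Z : topologicalType}.
Implicit Types (C : set Z) (p q : Z -> bool).

Lemma eq_clopen_on C p q : (forall z, C z -> p z = q z) ->
  clopen_on C p -> clopen_on C q.
Proof.
move=> pq cp b; rewrite (_ : _ `&` _ = C `&` [set z | p z = b])//.
by apply/seteqP; split=> z [Cz /= <-]; split=> //=; rewrite pq.
Qed.

Lemma clopen_on_cst C b : closed C -> clopen_on C (fun=> b).
Proof.
move=> cC c; have [->|bc] := eqVneq b c.
  by rewrite (_ : _ `&` _ = C)//; apply/seteqP; split=> z // [].
rewrite (_ : _ `&` _ = set0); first exact: closed0.
by apply/seteqP; split=> z // [_ /= e]; rewrite e eqxx in bc.
Qed.

Lemma clopen_on_addb C p q : clopen_on C p -> clopen_on C q ->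
  clopen_on C (fun z => p z (+) q z).
Proof.
move=> cp cq b.
rewrite (_ : _ `&` _ =
  ((C `&` [set z | p z = true]) `&` (C `&` [set z | q z = ~~ b])) `|`
  ((C `&` [set z | p z = false]) `&` (C `&` [set z | q z = b]))).
  by apply: closedU; apply: closedI.
apply/seteqP; split=> z /=.
  move=> [Cz <-]; case E : (p z); [left|right]; split; split=> //=.
  by rewrite negbK.
by move=> [|] [[Cz ->] [_ ->]]; split=> //; case: (b).
Qed.

Lemma clopen_on_bigaddb (I : Type) (r : seq I) C (p : I -> Z -> bool) :
  closed C -> (forall i, clopen_on C (p i)) ->
  clopen_on C (fun z => \big[addb/false]_(i <- r) p i z).
Proof.
move=> cC cp; elim: r => [|i r IH].
  apply: (@eq_clopen_on _ (fun=> false)); last exact: clopen_on_cst.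
  by move=> z _; rewrite big_nil.
apply: (@eq_clopen_on _ (fun z => p i z (+) \big[addb/false]_(j <- r) p j z)).
  by move=> z _; rewrite big_cons.
exact: clopen_on_addb.
Qed.

Lemma clopen_on_subset C A q : clopen_on C q -> closed A -> A `<=` C ->
  clopen_on A q.
Proof.
move=> cq cA AC b; rewrite (_ : _ `&` _ = A `&` (C `&` [set z | q z = b])).
  exact: closedI.
by apply/seteqP; split=> z; [move=> [Az qz]; split=> //; split=> //; exact: AC|
  move=> [Az [_ qz]]].
Qed.

Lemma clopen_on_glue (k : nat) (A : nat -> set Z) C q :
  (forall z, C z -> exists2 i, (i < k)%N & A i z) ->
  (forall i, (i < k)%N -> clopen_on (C `&` A i) q) -> clopen_on C q.
Proof.
move=> cov cq b; rewrite (_ : _ `&` _ =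
  \bigcup_(i in [set i | (i < k)%N]) ((C `&` A i) `&` [set z | q z = b])).
  by apply: closed_bigcup => [|i ik]; [exact: finite_II|exact: cq].
apply/seteqP; split=> z.
  by move=> [Cz qz]; have [i ik Az] := cov _ Cz; exists i.
by move=> [i _ [[Cz _] qz]].
Qed.

Lemma clopen_on_connected C q x y : clopen_on C q -> connected C ->
  C x -> C y -> q x = q y.
Proof.
move=> cq cC Cx Cy.
suff /esym e : C `&` [set z | q z = q x] = C by move: Cy; rewrite e => -[_ /= ->].
apply: cC; first by exists x.
  exists (~` (C `&` [set z | q z = ~~ q x])); first exact/closed_openC/cq.
  apply/seteqP; split=> z [Cz /= qz]; split=> //=.
    by move=> [_]; rewrite qz; case: (q x).
  by case E : (q z) qz; case: (q x) => // -[]; split=> //=; rewrite E.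
exists (C `&` [set z | q z = q x]); first exact: cq.
by rewrite setIA setIid.
Qed.

End clopen_on.

Lemma clopen_on_comp (S Z : topologicalType) (f : S -> Z) (C : set S)
    (C' : set Z) (q : Z -> bool) : continuous f -> closed C ->
  (forall z, C z -> C' (f z)) -> clopen_on C' q -> clopen_on C (q \o f).
Proof.
move=> cf cC CC' cq b.
rewrite (_ : _ `&` _ = C `&` f @^-1` (C' `&` [set z | q z = b])).
  by apply: closedI => //; apply: closed_comp => // z _; exact: cf.
by apply/seteqP; split=> z; [move=> [Cz qz]; split=> //; split=> //; exact: CC'|
  move=> [Cz [_ qz]]].
Qed.

(** The tails of the directed family [G] generate a proper filter; the near-covering form of
    compactness, applied to it, yields one member that works for all of [A]. *)
Lemma compact_directed (Z : topologicalType) (A : set Z) (G : set (set Z)) :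
  compact A -> G !=set0 -> (forall U, G U -> open U) ->
  (forall U V, G U -> G V -> exists2 W, G W & U `|` V `<=` W) ->
  A `<=` \bigcup_(U in G) U -> exists2 U, G U & A `<=` U.
Proof.
move=> /compact_near_coveringP cA [U0 GU0] oG dG AG.
pose F : set_system (set Z) := filter_from G (fun U => [set V | G V /\ U `<=` V]).
have FF : ProperFilter F.
  apply: filter_from_proper; last by move=> U GU; exists U; split.
  apply: filter_from_filter; first by exists U0.
  move=> U V GU GV; have [W GW UVW] := dG _ _ GU GV; exists W => //.
  by move=> W' [GW' WW']; split; split=> // z Wz; apply/WW'/UVW; [left|right].
have [|V [VG AV]] := @filter_ex _ F FF [set V | G V /\ A `<=` V].
  apply: filterI; first by exists U0 => // V [].
  apply: (cA _ F (fun V z => V z)) => z Az; have [U GU Uz] := AG _ Az.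
  exists (U, [set V | G V /\ U `<=` V]) => /=.
    by split; [exact: open_nbhs_nbhs (conj (oG _ GU) Uz)|exists U].
  by move=> [z' V] /= [Uz' [_ UV]]; exact: UV.
by exists V.
Qed.

(** * The ambient space: a base and countably many blocks of coordinates *)

Section ambient.
Context {R : realType} {T : pseudoMetricType R}.

Definition ambient : Type := (T * seqspace (seqspace R))%type.
HB.instance Definition _ :=
  PseudoMetric.copy ambient (T * seqspace (seqspace R))%type.
Implicit Types (z : ambient) (q : ambient -> bool).

Definition upd (n : nat) (v : seqspace R) (z : ambient) : ambient :=
  (z.1, fun m => if m == n then v else z.2 m).

(** A block holds the barycentric coordinates of a point in a graph. *)
Definition vertex (i : nat) : seqspace R := fun l => (l == i)%:R.

Definition edge (i j : nat) (t : R) : seqspace R :=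
  fun l => t * (l == i)%:R + (1 - t) * (l == j)%:R.

Definition cube : set (seqspace R) := [set v | forall l, `[0, 1]%classic (v l)].

Lemma edge1 i j : edge i j 1 = vertex i.
Proof. by apply/funext => l; rewrite /edge subrr mul0r mul1r addr0. Qed.

Lemma edge0 i j : edge i j 0 = vertex j.
Proof. by apply/funext => l; rewrite /edge subr0 mul0r mul1r add0r. Qed.

Lemma edge_id i t : edge i i t = vertex i.
Proof. by apply/funext => l; rewrite /edge -mulrDl addrC subrK mul1r. Qed.

Lemma edge_cube i j t : `[0, 1]%classic t -> cube (edge i j t).
Proof.
rewrite /= in_itv /= => /andP[t0 t1] l; rewrite /edge /= in_itv /=.
case: (l == i) (l == j) => -[]; rewrite ?mulr0 ?mulr1 ?addr0 ?add0r ?lexx ?ler01//.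
- by rewrite addrC subrK lexx ler01.
- by rewrite t0.
- by rewrite subr_ge0 t1 gerBl.
Qed.

Lemma vertex_cube i : cube (vertex i).
Proof. by rewrite -(edge1 i i); apply: edge_cube; rewrite /= in_itv/= ler01 lexx. Qed.

Lemma edge_continuous i j : continuous (edge i j).
Proof.
apply: continuous_seqspace => l t; apply: cvgD; apply: cvgMl.
  exact: cvg_id.
by apply: cvgB; [exact: cvg_cst|exact: cvg_id].
Qed.

Lemma edge_closed i j : closed (edge i j @` `[0, 1]%classic).
Proof.
apply: compact_closed.
  by apply: seqspace_hausdorff; exact: Rhausdorff.
apply: continuous_compact; last exact: segment_compact.
by apply: continuous_subspaceT; exact: edge_continuous.
Qed.

Lemma fst_ambient_continuous : continuous (fun z : ambient => z.1).
Proof. by move=> z; exact: cvg_fst. Qed.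

Lemma block_continuous n : continuous (fun z : ambient => z.2 n).
Proof.
move=> z; apply: (@continuous_comp _ _ _ snd (fun u : seqspace (seqspace R) => u n)).
  exact: cvg_snd.
exact: seqspace_proj_continuous.
Qed.

Lemma coord_continuous n l : continuous (fun z : ambient => z.2 n l).
Proof.
move=> z; apply: (@continuous_comp _ _ _ (fun z : ambient => z.2 n)
  (fun u : seqspace R => u l)); first exact: block_continuous.
exact: seqspace_proj_continuous.
Qed.

Lemma ambient_continuous (S : topologicalType) (f : S -> ambient) :
  continuous (fun s => (f s).1) ->
  (forall n, continuous (fun s => (f s).2 n)) -> continuous f.
Proof.
move=> c1 c2 s; apply/(@cvg_ballP _ ambient _ (nbhs s)) => e e0.
have /cvg_ballP/(_ e e0) h1 := c1 s.
have c2' : continuous (fun s => (f s).2) by exact: continuous_seqspace.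
have /cvg_ballP/(_ e e0) h2 := c2' s.
by apply: filterS2 h1 h2 => t b1 b2; split.
Qed.

Lemma upd_continuous n v : continuous (upd n v).
Proof.
apply: ambient_continuous; first exact: fst_ambient_continuous.
by move=> m /=; case: (m == n) => [z|]; [exact: cvg_cst|exact: block_continuous].
Qed.

Lemma upd_edge_continuous n i j z : continuous (fun t => upd n (edge i j t) z).
Proof.
apply: ambient_continuous; first by move=> t; exact: cvg_cst.
by move=> m /=; case: (m == n) => [|t]; [exact: edge_continuous|exact: cvg_cst].
Qed.

Lemma updxx n v z : (upd n v z).2 n = v.
Proof. by rewrite /= eqxx. Qed.

Lemma upd_neq n m v z : m != n -> (upd n v z).2 m = z.2 m.
Proof. by rewrite /= => /negPf ->. Qed.

Lemma upd_upd n v w z : upd n v (upd n w z) = upd n v z.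
Proof. by rewrite /upd /=; congr (_, _); apply/funext => m; case: eqP. Qed.

Lemma upd_self n z : upd n (z.2 n) z = z.
Proof.
case: z => x u; rewrite /upd /=; congr (_, _); apply/funext => m.
by case: eqP => [->|].
Qed.

Lemma ambient_hausdorff : hausdorff_space T -> hausdorff_space ambient.
Proof.
move=> hT; apply: prod_hausdorff => //.
by do 2 apply: seqspace_hausdorff; exact: Rhausdorff.
Qed.

Definition box (K : set T) : set ambient :=
  [set z | K z.1 /\ forall n, cube (z.2 n)].

Lemma box_compact K : compact K -> compact (box K).
Proof.
move=> cK; rewrite (_ : box K = K `*` [set u | forall n, cube (u n)]).
  apply: compact_setX => //; apply: seqspace_compact; apply: seqspace_compact.
  exact: segment_compact.
by [].
Qed.

Lemma box_upd K n v z : cube v -> box K z -> box K (upd n v z).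
Proof. by move=> cv [Kz cz]; split=> // m /=; case: ifP. Qed.

(** For open or closed [A] this amounts to depending only on the base point and the blocks below
    [n]. *)
Definition indep (n : nat) (A : set ambient) :=
  forall m v z, (n <= m)%N -> A z -> A (upd m v z).

Lemma indepE n A m v z : indep n A -> (n <= m)%N -> A (upd m v z) -> A z.
Proof. by move=> iA nm /(iA m (z.2 m) _ nm); rewrite upd_upd upd_self. Qed.

Lemma indepC n A : indep n A -> indep n (~` A).
Proof. by move=> iA m v z nm nA Az; apply: nA; exact: (indepE iA nm Az). Qed.

Lemma indepI n A A' : indep n A -> indep n A' -> indep n (A `&` A').
Proof. by move=> iA iA' m v z nm [Az Az']; split; [apply: iA|apply: iA']. Qed.

Lemma indep_interior n A : indep n A -> indep n A°.
Proof.
move=> iA m v z nm /= Az.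
have : nbhs (upd m v z) (upd m (z.2 m) @^-1` A).
  apply: (@upd_continuous m (z.2 m) (upd m v z)).
  by have -> : upd m (z.2 m) (upd m v z) = z by rewrite upd_upd upd_self.
by apply: filterS => w /= Aw; exact: (indepE iA nm Aw).
Qed.

Lemma indep_closure n A : indep n A -> indep n (closure A).
Proof.
move=> iA; rewrite -[closure A]setCK -interiorC.
by apply: indepC; apply: indep_interior; exact: indepC.
Qed.

(** The ball inspects only the blocks [l] with [l%:R * r < 1], all of them below [n]. *)
Lemma indep_ball c r n : 0 < r -> 1 <= n%:R * r -> indep n (ball c r).
Proof.
move=> r0 nr m v z nm [b1 [_ b2]]; split=> //; split=> // l lr.
have lm : (l < m)%N.
  rewrite -(@ltr_nat R) -(ltr_pM2r r0); apply: (lt_le_trans lr).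
  by apply: le_trans nr _; rewrite ler_pM2r// ler_nat.
rewrite upd_neq; first exact: b2.
by rewrite neq_ltn lm.
Qed.

End ambient.
Arguments ambient {R} T.

(** * Steps, that is, families of graphs over the earlier blocks, and their parity transfer *)

Section steps.
Context {R : realType} {T : pseudoMetricType R}.
Implicit Types (z : ambient T) (q : ambient T -> bool).

(* Over a point [z] of the base a step places the vertex [i] if
   [z \in cell i i] and the edge [ij] if [z \in cell i j]. The sequence
   [sel z] lists vertices over [z]; the parity of the number of those that
   satisfy [q] plays the role of a degree, see [transfer]. *)
Record step := Step {
  arity : nat;
  cell : nat -> nat -> set (ambient T);
  sel : ambient T -> seq nat }.

Definition stepset n (s : step) : set (ambient T) :=
  [set z | exists i j, [/\ (i < arity s)%N, (j < arity s)%N, cell s i j z &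
                           (edge i j @` `[0, 1]%classic) (z.2 n)]].

Definition transfer n (s : step) q z : bool :=
  \big[addb/false]_(i <- sel s z) q (upd n (vertex i) z).

Definition fiberwise n (C : set (ambient T)) :=
  forall z v, cube v -> C z -> C (upd n v z).

(** What the parity argument asks of a step: total parity 1, selected vertices that are really
    present, and a transfer that keeps relative clopenness. *)
Record valid_step (B : set T) n (s : step) : Prop := ValidStep {
  cell_closed : forall i j, closed (cell s i j);
  cell_indep : forall i j, indep n (cell s i j);
  sel_odd : forall z, odd (size (sel s z));
  sel_cell : forall z i, box B z -> i \in sel s z ->
    (i < arity s)%N /\ cell s i i z;
  transfer_clopen : forall C q, C `<=` box B -> closed C -> fiberwise n C ->
    clopen_on (C `&` stepset n s) q -> clopen_on C (transfer n s q) }.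

Lemma transfer_addb n s p q z :
  transfer n s (fun z => p z (+) q z) z = transfer n s p z (+) transfer n s q z.
Proof. exact: big_split. Qed.

Lemma transfer_true n s z : odd (size (sel s z)) -> transfer n s (fun=> true) z.
Proof.
suff -> : transfer n s (fun=> true) z = odd (size (sel s z)) by [].
rewrite /transfer; elim: (sel s z) => [|i r IH]; first by rewrite big_nil.
by rewrite big_cons IH.
Qed.

Lemma transfer_ex n s q z : transfer n s q z ->
  exists2 i, i \in sel s z & q (upd n (vertex i) z).
Proof.
rewrite /transfer; elim: (sel s z) => [|i r IH]; first by rewrite big_nil.
rewrite big_cons; case E : (q _); first by exists i; rewrite ?mem_head.
by rewrite addFb => /IH [j jr qj]; exists j => //; rewrite inE jr orbT.
Qed.

Lemma edge_stepset n s i j t z : indep n (cell s i j) ->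
  (i < arity s)%N -> (j < arity s)%N -> cell s i j z -> `[0, 1]%classic t ->
  stepset n s (upd n (edge i j t) z).
Proof.
move=> ind ik jk cz t01; exists i, j; split=> //; first exact: ind.
by rewrite updxx; exists t.
Qed.

Lemma vertex_stepset n s i z : indep n (cell s i i) ->
  (i < arity s)%N -> cell s i i z -> stepset n s (upd n (vertex i) z).
Proof.
move=> ind ik cz; rewrite -(edge1 i i); apply: edge_stepset => //.
by rewrite /= in_itv /= ler01 lexx.
Qed.

Lemma stepset_closed n s : (forall i j, closed (cell s i j)) ->
  closed (stepset n s).
Proof.
move=> cc; rewrite (_ : stepset n s =
  \bigcup_(i in [set i | (i < arity s)%N]) \bigcup_(j in [set j | (j < arity s)%N])
    (cell s i j `&` (fun z : ambient T => z.2 n) @^-1` (edge i j @` `[0, 1]%classic))).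
  do 2 (apply: closed_bigcup; [exact: finite_II|move=> ? ?]).
  apply: closedI => //; apply: closed_comp; last exact: edge_closed.
  by move=> z _; exact: block_continuous.
apply/seteqP; split=> z.
  by move=> [i [j [ik jk cz ez]]]; exists i => //; exists j.
by move=> [i ik [j jk [cz ez]]]; exists i, j.
Qed.

Lemma stepset_indep n s : (forall i j, indep n (cell s i j)) ->
  indep n.+1 (stepset n s).
Proof.
move=> ci m v z nm [i [j [ik jk cz ez]]]; exists i, j; split=> //.
  by apply: ci => //; exact: ltnW.
by rewrite upd_neq// neq_ltn nm.
Qed.

(** The edge is a path inside one fibre, and a relatively clopen predicate is constant along it. *)
Lemma clopen_on_edge n s (C : set (ambient T)) q i j z : fiberwise n C ->
  clopen_on (C `&` stepset n s) q -> indep n (cell s i j) ->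
  (i < arity s)%N -> (j < arity s)%N -> cell s i j z -> C z ->
  q (upd n (vertex i) z) = q (upd n (vertex j) z).
Proof.
move=> fC cq ind ik jk cz Cz; rewrite -(edge1 i j) -(edge0 i j).
pose f t := upd n (edge i j t) z.
rewrite -/(f 1) -/(f 0) -[LHS]/((q \o f) 1) -[RHS]/((q \o f) 0).
apply: (@clopen_on_connected R `[0, 1]%classic).
- apply: clopen_on_comp cq; first exact: upd_edge_continuous.
    exact: interval_closed.
  move=> t t01; split; first by apply: fC => //; exact: edge_cube.
  exact: edge_stepset.
- exact: segment_connected.
- by rewrite /= in_itv /= ler01 lexx.
- by rewrite /= in_itv /= ler01 lexx.
Qed.

(** Each summand is the pullback of [q] along the continuous section that places vertex [i] over
    [z]; over [A] this section stays in the step set. *)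
Lemma clopen_on_vertices n s (C A : set (ambient T)) q (r : seq nat) :
  closed C -> closed A -> fiberwise n C ->
  clopen_on (C `&` stepset n s) q ->
  (forall i, i \in r -> (i < arity s)%N /\ A `<=` cell s i i) ->
  (forall i, indep n (cell s i i)) ->
  clopen_on (C `&` A) (fun z => \big[addb/false]_(i <- r) q (upd n (vertex i) z)).
Proof.
move=> cC cA fC cq rA ind.
apply: (@eq_clopen_on _ _ (fun z => \big[addb/false]_(i <- r)
    (if i \in r then q (upd n (vertex i) z) else false))).
  by move=> z _; apply: eq_big_seq => i ->.
apply: clopen_on_bigaddb; first exact: closedI.
move=> i; case: (boolP (i \in r)) => [ir|_]; last by apply: clopen_on_cst; exact: closedI.
apply: (clopen_on_comp (@upd_continuous R T n (vertex i)) _ _ cq).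
  exact: closedI.
move=> z [Cz Az]; split; first by apply: fC => //; exact: vertex_cube.
by have [ik Ac] := rA _ ir; apply: vertex_stepset => //; exact: Ac.
Qed.

End steps.
Arguments step {R} T.

(** * The tower of steps and oddness over a continuum *)

Section tower.
Context {R : realType} {T : pseudoMetricType R}.
Variables (B : set T) (s : nat -> step T).
Hypothesis hT : hausdorff_space T.
Hypothesis cB : compact B.
Hypothesis sP : forall n, valid_step B n (s n).
Implicit Types (z : ambient T) (q : ambient T -> bool) (K : set T).
Implicit Types (M : set (ambient T)).

Definition level K N : set (ambient T) :=
  [set z | box K z /\ forall n, (n < N)%N -> stepset n (s n) z].

Definition limit K : set (ambient T) :=
  [set z | box K z /\ forall n, stepset n (s n) z].

Fixpoint tower N q : ambient T -> bool :=
  if N is N'.+1 then tower N' (transfer N' (s N') q) else q.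

(** A continuous section on which parities are evaluated: [tower N] overwrites the blocks below [N]
    by vertices, the others stay 0. *)
Definition base (x : T) : ambient T := (x, fun _ _ => 0).

(** The witness lives at a finite level, where parity is defined; testing it against neighbourhoods
    lets [M] be a subset of the limit. *)
Definition odd_on K M := forall O, open O -> M `<=` O ->
  exists N q, [/\ clopen_on (level K N) q,
                  forall z, level K N z -> q z -> O z &
                  forall x, K x -> tower N q (base x)].

Lemma levelS K N : level K N.+1 = level K N `&` stepset N (s N).
Proof.
apply/seteqP; split=> z.
  move=> [bz sz]; split; last exact: sz.
  by split=> // n nN; apply: sz; exact: ltnW.
move=> [[bz sz] sN]; split=> // n; rewrite ltnS leq_eqVlt => /orP[/eqP -> //|].
exact: sz.
Qed.

Lemma level_le K N N' : (N <= N')%N -> level K N' `<=` level K N.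
Proof. by move=> NN z [bz sz]; split=> // n nN; apply: sz; exact: leq_trans NN. Qed.

Lemma level_sub K K' N : K `<=` K' -> level K N `<=` level K' N.
Proof. by move=> KK z [[Kz cz] sz]; split=> //; split=> //; exact: KK. Qed.

Lemma ambient_compact_closed K : compact K -> closed (box K).
Proof.
move=> cK; apply: compact_closed; last exact: box_compact.
exact: ambient_hausdorff.
Qed.

Lemma stepset_closed_s n : closed (stepset n (s n)).
Proof. by apply: stepset_closed => i j; exact: (cell_closed (sP n)). Qed.

Lemma level_closed K N : compact K -> closed (level K N).
Proof.
move=> cK; elim: N => [|N IH].
  rewrite (_ : level K 0 = box K); first exact: ambient_compact_closed.
  by apply/seteqP; split=> z; [case|].
by rewrite levelS; apply: closedI => //; exact: stepset_closed_s.
Qed.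

Lemma limit_closed K : compact K -> closed (limit K).
Proof.
move=> cK; rewrite (_ : limit K = \bigcap_N level K N).
  by apply: closed_bigI => N _; exact: level_closed.
apply/seteqP; split=> z.
  by move=> [bz sz] N _; split.
by move=> lz; split; [case: (lz 0%N I)|move=> n; case: (lz n.+1 I) => _; apply].
Qed.

Lemma level_fiberwise K N : fiberwise N (level K N).
Proof.
move=> z v cv [bz sz]; split; first exact: box_upd.
move=> n nN; apply: (@stepset_indep _ _ n) => //; last exact: sz.
by move=> i j; exact: (cell_indep (sP n)).
Qed.

Lemma tower_addb N p q z :
  tower N (fun z => p z (+) q z) z = tower N p z (+) tower N q z.
Proof.
elim: N p q => //= N IH p q; rewrite -IH; congr (tower N _ z).
by apply/funext => w; exact: transfer_addb.
Qed.

Lemma tower_true N z : tower N (fun=> true) z.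
Proof.
elim: N => //= N IH.
rewrite (_ : transfer _ _ _ = fun=> true)//.
by apply/funext => w; apply: transfer_true; exact: (sel_odd (sP N)).
Qed.

(** An odd number of vertices is not zero, so one can be kept at each step. *)
Lemma tower_ex K N q z : K `<=` B -> box K z -> tower N q z ->
  exists z', [/\ level K N z', z'.1 = z.1 & q z'].
Proof.
move=> KB; elim: N q => [|N IH] q bz /=.
  by move=> qz; exists z; split=> //; split.
move=> /(IH _ bz) [w [lw wz tw]]; have [i iw qw] := transfer_ex tw.
exists (upd N (vertex i) w); split=> //=.
have [ik cw] : (i < arity (s N))%N /\ cell (s N) i i w.
  apply: (sel_cell (sP N)) iw; have [[Kw cw] _] := lw.
  by split=> //; exact: KB.
rewrite levelS; split; first by apply: level_fiberwise => //; exact: vertex_cube.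
by apply: vertex_stepset => //; exact: (cell_indep (sP N)).
Qed.

Lemma tower_clopen K N q : compact K -> K `<=` B -> clopen_on (level K N) q ->
  clopen_on (level K 0) (tower N q).
Proof.
move=> cK KB; elim: N q => //= N IH q cq; apply: IH.
apply: (transfer_clopen (sP N)); last by rewrite -levelS.
- by move=> z [[Kz cz] _]; split=> //; exact: KB.
- exact: level_closed.
- exact: level_fiberwise.
Qed.

Lemma base_continuous : continuous base.
Proof.
by apply: ambient_continuous => [x|n x]; [exact: cvg_id|exact: cvg_cst].
Qed.

Lemma base_box K x : K x -> box K (base x).
Proof. by move=> Kx; split=> // n l; rewrite /= in_itv /= lexx ler01. Qed.

Lemma tower_const K N q x y : compact K -> connected K -> K `<=` B ->
  clopen_on (level K N) q -> K x -> K y -> tower N q (base x) = tower N q (base y).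
Proof.
move=> cK conK KB cq Kx Ky.
rewrite -[LHS]/((tower N q \o base) x) -[RHS]/((tower N q \o base) y).
apply: (@clopen_on_connected _ K) => //.
apply: (clopen_on_comp base_continuous _ _ (tower_clopen cK KB cq)).
  exact: compact_closed.
by move=> t Kt; split=> //; exact: base_box.
Qed.

(** The closed levels decrease to the limit, so by compactness one of them lies in [O]; the constant
    predicate [true] has parity 1. *)
Lemma odd_on_limit : odd_on B (limit B).
Proof.
move=> O oO LO.
have cBO : compact (box B `&` ~` O).
  by apply: compact_closedI; [exact: box_compact|exact: open_closedC].
have [|U [N _ <-]|U V [N _ <-] [N' _ <-]|z [bz nOz]|U [N _ <-] BN] :=
    @compact_directed _ _ [set ~` level B N | N in setT] cBO.
- by exists (~` level B 0), 0%N.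
- by apply: closed_openC; exact: level_closed.
- exists (~` level B (maxn N N')); first by exists (maxn N N').
  move=> z [|] nz lz; apply: nz; apply: level_le lz.
    exact: leq_maxl.
  exact: leq_maxr.
- apply: contrapT => nz; apply: nOz; apply: LO; split=> //.
  move=> n; apply: contrapT => nsz; apply: nz.
  exists (~` level B n.+1); first by exists n.+1.
  by move=> [_ sz]; apply: nsz; exact: sz.
exists N, (fun=> true); split; [| |by move=> x _; exact: tower_true].
  by apply: clopen_on_cst; exact: level_closed.
move=> z lz _; apply: contrapT => nOz.
by apply: (BN z) => //; split=> //; case: lz.
Qed.

(** Adding to [O] the complement of the preimage of [K] gives a neighbourhood of [M]; over [K] its
    witness ends up in [O]. *)
Lemma odd_on_restrict K M : compact K -> K `<=` B -> odd_on B M ->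
  odd_on K (M `&` [set z | K z.1]).
Proof.
move=> cK KB oM O oO MO.
have cpK : closed [set z : ambient T | K z.1].
  apply: (@closed_comp _ _ (fun z : ambient T => z.1) K).
    by move=> z _; exact: fst_ambient_continuous.
  exact: compact_closed.
have [||N [q [cq qO tq]]] := oM (O `|` ~` [set z | K z.1]).
- by apply: openU => //; exact: closed_openC.
- move=> z Mz; have [Kz|nKz] := pselect (K z.1); last by right.
  by left; apply: MO.
exists N, q; split.
- by apply: clopen_on_subset cq _ _; [exact: level_closed|exact: level_sub].
- move=> z lz qz; have [//|] := qO z (level_sub KB lz) qz.
  by case: lz => -[Kz _] _ /(_ Kz).
- by move=> x Kx; apply: tq; exact: KB.
Qed.

(** If [M] missed the fibre over [x], the complement of the fibre would be a neighbourhood of [M],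
    yet parity 1 at [x] produces a point of the fibre that satisfies the witness. *)
Lemma odd_on_surj K M x : K `<=` B -> odd_on K M -> K x ->
  exists2 z, M z & z.1 = x.
Proof.
move=> KB oM Kx; apply: contrapT => nx.
have cx : closed [set z : ambient T | z.1 = x].
  apply: (@closed_comp _ _ (fun z : ambient T => z.1) [set x]).
    by move=> z _; exact: fst_ambient_continuous.
  by apply: compact_closed => //; exact: compact_set1.
have [||N [q [_ qO tq]]] := oM (~` [set z : ambient T | z.1 = x]).
- exact: closed_openC.
- by move=> z Mz zx; apply: nx; exists z.
have [z [lz zx qz]] := tower_ex KB (base_box Kx) (tq x Kx).
exact: qO lz qz zx.
Qed.


(** Disjoint neighbourhoods of [M1] and [M2] cut a witness for [M] into two clopen parts whose
    parities add up to 1. Each parity is constant over [K], so one part has parity 1 throughout. *)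
Lemma odd_on_split K M M1 M2 : is_continuum K -> K `<=` B ->
  closed M1 -> closed M2 -> M1 `&` M2 = set0 -> M `<=` M1 `|` M2 ->
  odd_on K M -> odd_on K M1 \/ odd_on K M2.
Proof.
move=> [[x0 Kx0] [cK conK]] KB cM1 cM2 M12 MM12 oM.
apply: contrapT => /not_orP[].
move=> /existsNP[W1 /not_implyP[oV1 /not_implyP[MW1 n1]]].
move=> /existsNP[W2 /not_implyP[oV2 /not_implyP[MW2 n2]]].
have := @pseudometric_normal R (ambient T).
move=> /(@normal_openP R) /(_ M1 M2 cM1 cM2 M12) [U1 [U2 [oU1 oU2 MU1 MU2 U12]]].
have oW1 : open (W1 `&` U1) by exact: openI.
have oW2 : open (W2 `&` U2) by exact: openI.
have [||N [q [cq qO tq]]] := oM ((W1 `&` U1) `|` (W2 `&` U2)).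
- exact: openU.
- move=> z /MM12 [Mz|Mz].
    by left; split; [exact: MW1|exact: MU1].
  by right; split; [exact: MW2|exact: MU2].
have disj z : U1 z -> U2 z -> False.
  by move=> u1 u2; rewrite -[False]/(set0 z) -U12.
pose q1 z := q z && `[< (W1 `&` U1) z >].
pose q2 z := q z (+) q1 z.
have q2E z : level K N z -> q2 z -> (W2 `&` U2) z.
  rewrite /q2 /q1 => lz; case E : (q z) => //=.
  by case: asboolP => //= nW _; have [] := qO z lz E.
(* Where [q] holds, being outside one of the two open sets is a closed condition; [q1] is true
   outside the second and false outside the first. *)
have cq1 : clopen_on (level K N) q1.
  case.
    rewrite (_ : _ `&` _ = (level K N `&` [set z | q z = true]) `&` ~` (W2 `&` U2)).
      by apply: closedI; [exact: cq|exact: open_closedC].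
    apply/seteqP; split=> z /=; rewrite /q1.
      move=> [lz /andP[qz /asboolP[_ u1]]]; split=> // -[_ u2].
      exact: disj u1 u2.
    move=> [[lz qz] nW]; split=> //; rewrite qz /=; apply/asboolP.
    by have [] := qO z lz qz.
  rewrite (_ : _ `&` _ = (level K N `&` [set z | q z = false]) `|`
      ((level K N `&` [set z | q z = true]) `&` ~` (W1 `&` U1))).
    by apply: closedU; [exact: cq|apply: closedI; [exact: cq|exact: open_closedC]].
  apply/seteqP; split=> z /=; rewrite /q1.
    move=> [lz /negbT]; rewrite negb_and; case E : (q z) => /=; last by left.
    by move=> /asboolPn nW; right; split.
  move=> [[lz ->]//|[[lz ->] nW]]; split=> //=.
  by apply/negbTE/asboolPn.
have cq2 : clopen_on (level K N) q2 by exact: clopen_on_addb.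
have := tower_addb N q1 q2 (base x0).
rewrite (_ : (fun z => _) = q); last first.
  by apply/funext => z; rewrite /q2 addbCA addbb addbF.
rewrite (tq _ Kx0); case E1 : (tower N q1 _) => /=.
  move=> _; apply: n1; exists N, q1; split=> //.
    by move=> z lz; rewrite /q1 => /andP[_ /asboolP[]].
  by move=> x Kx; rewrite (tower_const cK conK KB cq1 Kx Kx0).
move=> /esym E2; apply: n2; exists N, q2; split=> //.
  by move=> z lz qz; have [] := q2E z lz qz.
by move=> x Kx; rewrite (tower_const cK conK KB cq2 Kx Kx0).
Qed.

Lemma odd_on_nonempty K M : is_continuum K -> K `<=` B -> odd_on K M -> M !=set0.
Proof.
move=> [[x Kx] _] KB oM.
by have [z Mz _] := odd_on_surj KB oM Kx; exists z.
Qed.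

(** A minimal odd closed subset of [M] is connected: of two disjoint closed pieces one would be odd,
    against minimality. *)
Lemma odd_on_connected K M : is_continuum K -> K `<=` B -> compact M ->
  odd_on K M -> exists2 M', M' `<=` M & is_continuum M' /\ odd_on K M'.
Proof.
move=> KC KB cM oM.
have clM : closed M by apply: compact_closed => //; exact: ambient_hausdorff.
(* Zorn's lemma is applied to the removed open sets, so that a maximal one leaves a minimal odd
   set. *)
pose P U := open U /\ odd_on K (M `\` U).
have [F FP Ftot|A [[oA oMA] Amax]] := @Zorn_bigcup _ P.
  split; first by apply: bigcup_open => U /FP [].
  move=> O oO MO.
  have [F0|/set0P Fn] := eqVneq F set0.
    by apply: oM => // z Mz; apply: MO; split=> // -[U]; rewrite F0.
  have cMO : compact (M `&` ~` O).
    by apply: compact_closedI => //; exact: open_closedC.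
  have [U /FP []//|U V FU FV|z [Mz nOz]|U FU MU] := compact_directed cMO Fn.
  - by have [UV|VU] := Ftot _ _ FU FV; [exists V => // z [/UV|]|exists U => // z [|/VU]].
  - by apply: contrapT => nz; apply: nOz; apply: MO; split.
  have [_] := FP _ FU; apply=> // z [Mz nUz].
  by apply: contrapT => nOz; apply: nUz; exact: MU.
have clMA : closed (M `\` A) by rewrite setDE; apply: closedI => //; exact: open_closedC.
exists (M `\` A); first by move=> z [].
split=> //; split; first exact: odd_on_nonempty oMA.
split; first by apply: subclosed_compact clMA cM _ => z [].
move=> S [z0 Sz0] [C oC SC] [C' cC' SC'].
have clS : closed S by rewrite SC'; exact: closedI.
have clS' : closed (M `\` A `\` C).
  by rewrite setDE; apply: closedI => //; exact: open_closedC.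
apply: contrapT => neq.
have [z1 [Mz1 nCz1]] : (M `\` A `\` C) !=set0.
  apply/set0P/eqP => e0; apply: neq; rewrite SC; apply/seteqP; split=> z; first by case.
  move=> Mz; split=> //; apply: contrapT => nCz.
  by rewrite -[False]/(set0 z) -e0.
(* If a proper closed part [S0] were odd, adding its complement to [A] would contradict
   maximality. *)
have not_odd S0 z : closed S0 -> S0 `<=` M `\` A -> (M `\` A) z -> ~ S0 z ->
    ~ odd_on K S0.
  move=> clS0 S0M Mz nSz oS; apply: (Amax (A `|` ~` S0)).
    split; first by move=> ? ?; left.
    by move=> /(_ z); case: Mz => _ nA h; apply/nA/h; right.
  split; first by apply: openU => //; exact: closed_openC.
  rewrite (_ : _ `\` _ = S0)//; apply/seteqP; split=> w.
    by move=> [Mw nw]; apply: contrapT => nSw; apply: nw; right.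
  by move=> Sw; have [Mw nA] := S0M _ Sw; split=> // -[].
have [|||oS|oS] := @odd_on_split K (M `\` A) S (M `\` A `\` C) KC KB clS clS'.
- by rewrite SC; apply/seteqP; split=> z // -[[_ ?] [_]].
- by rewrite SC => z Mz; have [Cz|nCz] := pselect (C z); [left|right].
- by [].
- apply: (not_odd S z1) => //; rewrite SC; first by move=> z [h _]; exact: h.
  by move=> [_ /nCz1].
- apply: (not_odd (M `\` A `\` C) z0) => //.
    by move: Sz0; rewrite SC => -[h _]; exact: h.
  by move: Sz0; rewrite SC => -[_ ? [_]].
Qed.

Theorem tower_continuum : is_continuum B -> exists M : set (ambient T),
  [/\ M `<=` limit B, is_continuum M &
      forall K, is_continuum K -> K `<=` B -> exists M',
        [/\ M' `<=` M, is_continuum M' & (fun z : ambient T => z.1) @` M' = K]].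
Proof.
move=> BC.
have cL : compact (limit B).
  apply: (subclosed_compact (limit_closed cB) (box_compact cB)).
  by move=> z [].
have [M ML [MC oM]] := odd_on_connected BC (@subset_refl _ B) cL odd_on_limit.
exists M; split=> // K KC KB.
have cK : compact K by case: KC => _ [].
have cMK : compact (M `&` [set z | K z.1]).
  apply: compact_closedI; first by case: MC => _ [].
  apply: (@closed_comp _ _ (fun z : ambient T => z.1) K).
    by move=> z _; exact: fst_ambient_continuous.
  exact: compact_closed.
have oK := odd_on_restrict cK KB oM.
have [M' M'M [M'C oM']] := odd_on_connected KC KB cMK oK.
exists M'; split=> //; first by move=> z /M'M [].
apply/seteqP; split=> [_ [z /M'M [_ Kz] <-]//|x Kx].
by have [z Mz zx] := odd_on_surj KB oM' Kx; exists z.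
Qed.

End tower.

(** * Cover steps *)

Section cover_step.
Context {R : realType} {T : pseudoMetricType R}.
Variables (k : nat) (F : nat -> set (ambient T)).

(** Taking the first available vertex is arbitrary: all vertices over a point are joined, so any of
    them gives a clopen predicate the same parity. *)
Definition cover_step : step T := Step k (fun i j => F i `&` F j)
  (fun z => [:: find (fun i => `[< F i z >]) (iota 0 k)]).

Lemma cover_find z : (exists2 i, (i < k)%N & F i z) ->
  (find (fun i => `[< F i z >]) (iota 0 k) < k)%N /\
  F (find (fun i => `[< F i z >]) (iota 0 k)) z.
Proof.
move=> [i ik Fi].
have h : has (fun i => `[< F i z >]) (iota 0 k).
  by apply/hasP; exists i; [rewrite mem_iota|exact/asboolP].
have lt : (find (fun i => `[< F i z >]) (iota 0 k) < k)%N.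
  by move: h; rewrite has_find size_iota.
split=> //; have /asboolP := nth_find 0%N h.
by rewrite nth_iota// add0n.
Qed.

Lemma cover_step_valid B n : (forall i, closed (F i)) ->
  (forall i, indep n (F i)) ->
  (forall z, box B z -> exists2 i, (i < k)%N & F i z) ->
  valid_step B n cover_step.
Proof.
move=> cF iF covF; split => //=.
- by move=> i j; exact: closedI.
- by move=> i j; exact: indepI.
- move=> z i bz; rewrite inE => /eqP ->.
  by have [ik Fi] := cover_find (covF _ bz).
move=> C q CB cC fC cq.
apply: (@clopen_on_glue _ k F) => [z Cz|i ik]; first exact/covF/CB.
apply: (@eq_clopen_on _ _ (fun z => \big[addb/false]_(i <- [:: i]) q (upd n (vertex i) z))).
  move=> z [Cz Fz]; rewrite /transfer /= !big_seq1.
  have [fk Ff] := cover_find (covF _ (CB _ Cz)).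
  by apply: (clopen_on_edge fC cq) => //=; exact: indepI.
apply: (@clopen_on_vertices _ _ n cover_step) => //.
  by move=> j; rewrite inE => /eqP ->.
by move=> j; exact: indepI.
Qed.

(** The open star of vertex [l] is the set where coordinate [l] is positive. Every point lies in one
    or two stars, and the star of [l] lies over [F l]. *)
Lemma cover_step_star n z : stepset n cover_step z -> exists i j,
  [/\ (i < k)%N, (j < k)%N, F i z /\ F j z,
      (forall l, 0 < z.2 n l -> l = i \/ l = j) &
      0 < z.2 n i \/ 0 < z.2 n j].
Proof.
move=> [i [j [ik jk [Fi Fj] [t]]]]; rewrite /= in_itv /= => /andP[t0 t1] <-.
exists i, j; split=> //.
  move=> l; rewrite /edge; case: eqP => [|_]; first by left.
  by case: eqP => [|_]; [right|rewrite !mulr0 addr0 ltxx].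
rewrite /edge !eqxx; have [->|tn] := eqVneq t 0.
  by right; rewrite mul0r add0r subr0 mulr1 ltr01.
left; rewrite mulr1 ltr_pwDl//; first by rewrite lt_def tn.
by rewrite mulr_ge0// subr_ge0.
Qed.

End cover_step.

(** * Fold steps and the separation of crossing subcontinua *)

Section fold_step.
Context {R : realType} {T : pseudoMetricType R}.
Variables (U V : set (ambient T)).

(* The three sheets of a fold: [~` V], [~` (U `|` V)] and [~` U], glued along
   the boundaries of [V] and of [U]. *)
Definition fold_cell (i j : nat) : set (ambient T) :=
  match i, j with
  | 0, 0 => ~` V
  | 1, 1 => ~` (U `|` V)
  | 2, 2 => ~` U
  | 0, 1 => closure V `&` ~` V
  | 1, 2 => closure U `&` ~` U
  | _, _ => set0
  end%N.

(** For disjoint [U] and [V] all sheets present over [z] are selected: one over [U] or [V], three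
    elsewhere. *)
Definition fold_step : step T := Step 3 fold_cell
  (fun z => if `[< U z >] then [:: 0] else
            if `[< V z >] then [:: 2] else [:: 0; 1; 2])%N.

Lemma fold_cellP i j z : fold_cell i j z ->
  [\/ [/\ i = 0%N, j = 0%N & ~ V z], [/\ i = 1%N, j = 1%N & ~ (U `|` V) z],
      [/\ i = 2%N, j = 2%N & ~ U z] |
      [/\ i = 0%N, j = 1%N, closure V z & ~ V z] \/
      [/\ i = 1%N, j = 2%N, closure U z & ~ U z]].
Proof.
case: i => [|[|[|i]]]; case: j => [|[|[|j]]] //= H.
- by constructor 1.
- by constructor 4; left; case: H.
- by constructor 2.
- by constructor 4; right; case: H.
- by constructor 3.
Qed.

(** At the boundary of [U] the last two sheets meet and cancel mod 2, so the first one alone gives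
    the parity on all of [closure U]; likewise the third on [closure V]. On the remaining closed set
    all three are present. *)
Lemma fold_step_valid B n : open U -> open V -> closure U `&` closure V = set0 ->
  indep n U -> indep n V -> valid_step B n fold_step.
Proof.
move=> oU oV UV iU iV.
have disj z : closure U z -> closure V z -> False.
  by move=> u v; rewrite -[False]/(set0 z) -UV.
have sU := @subset_closure _ U; have sV := @subset_closure _ V.
have cUV : closed (~` (U `|` V)) by apply: open_closedC; exact: openU.
have iUV : indep n (~` (U `|` V)).
  by rewrite setCU; apply: indepI; exact: indepC.
have cc : forall i j, closed (fold_cell i j).
  move=> [|[|[|i]]] [|[|[|j]]] //=; try exact: closed0; try exact: open_closedC.
    by apply: closedI; [exact: closed_closure|exact: open_closedC].
  by apply: closedI; [exact: closed_closure|exact: open_closedC].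
have ci : forall i j, indep n (fold_cell i j).
  move=> [|[|[|i]]] [|[|[|j]]] //=; try exact: indepC.
    by apply: indepI; [exact: indep_closure|exact: indepC].
  by apply: indepI; [exact: indep_closure|exact: indepC].
split=> //.
- by move=> z /=; case: asboolP => //; case: asboolP.
- move=> z i _ /=; case: asboolP => [Uz|nU].
    by rewrite inE => /eqP -> /=; split=> // Vz; exact: disj (sU _ Uz) (sV _ Vz).
  case: asboolP => [Vz|nV]; first by rewrite inE => /eqP ->.
  by rewrite !inE => /or3P[] /eqP -> //=; split=> // -[].
move=> C q CB cC fC cq.
(* The default of [nth] supplies the third piece, [closure V]. *)
pose A i := nth (closure V) [:: closure U; ~` (U `|` V)] i.
apply: (@clopen_on_glue _ 3 A) => [z Cz|[|[|[|//]]] _ /=].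
- have [Uz|nU] := pselect (U z); first by exists 0%N => //; exact: sU.
  have [Vz|nV] := pselect (V z); first by exists 2%N => //; exact: sV.
  by exists 1%N => // -[].
- apply: (@eq_clopen_on _ _ (fun z => \big[addb/false]_(i <- [:: 0%N]) q (upd n (vertex i) z))).
    move=> z [Cz Uz]; rewrite /transfer /=; case: asboolP => // nU.
    case: asboolP => [/sV Vz|nV]; first by case: (disj z).
    rewrite !big_cons !big_nil (clopen_on_edge fC cq (ci 1 2)%N)//.
    by rewrite !addbF addbb addbF.
  apply: (clopen_on_vertices (s := fold_step)) => //; first exact: closed_closure.
  move=> i; rewrite inE => /eqP -> /=; split=> // z Uz Vz.
  exact: disj Uz (sV _ Vz).
- apply: (@eq_clopen_on _ _ (fun z => \big[addb/false]_(i <- [:: 0; 1; 2]%N) q (upd n (vertex i) z))).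
    move=> z [Cz nUV]; rewrite /transfer /=; case: asboolP => [Uz|_].
      by case: nUV; left.
    by case: asboolP => [Vz|//]; case: nUV; right.
  apply: (clopen_on_vertices (s := fold_step)) => //.
  by move=> i; rewrite !inE => /or3P[] /eqP -> /=; split=> // z nUV ?; apply: nUV;
    [right|left].
- apply: (@eq_clopen_on _ _ (fun z => \big[addb/false]_(i <- [:: 2%N]) q (upd n (vertex i) z))).
    move=> z [Cz Vz]; rewrite /transfer /=.
    case: asboolP => [/sU Uz|nU]; first by case: (disj z).
    case: asboolP => // nV.
    rewrite !big_cons !big_nil (clopen_on_edge fC cq (ci 0 1)%N)//.
    by rewrite addbA addbb.
  apply: (clopen_on_vertices (s := fold_step)) => //; first exact: closed_closure.
  move=> i; rewrite inE => /eqP -> /=; split=> // z Vz Uz.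
  exact: disj (sU _ Uz) Vz.
Qed.

Lemma connected_coord01 (n l : nat) (A : set (ambient T)) a z :
  closed A -> connected A ->
  (forall z, A z -> z.2 n l = 0 \/ z.2 n l = 1) ->
  A a -> a.2 n l = 1 -> A z -> z.2 n l = 1.
Proof.
move=> cA conA A01 Aa a1 Az.
have clopenA : clopen_on A (fun z => z.2 n l == 1).
  have closedc (c : R) : closed (A `&` [set z | z.2 n l = c]).
    apply: closedI => //.
    apply: (@closed_comp _ _ (fun z : ambient T => z.2 n l) [set c]).
      by move=> ? _; exact: coord_continuous.
    by apply: compact_closed; [exact: Rhausdorff|exact: compact_set1].
  case.
    rewrite (_ : _ `&` _ = A `&` [set z | z.2 n l = 1])//.
    by apply/seteqP; split=> w [Aw /eqP e]; split=> //; apply/eqP.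
  rewrite (_ : _ `&` _ = A `&` [set z | z.2 n l = 0])//.
  apply/seteqP; split=> w [Aw /= e]; split=> //=.
    by have [//|e1] := A01 _ Aw; rewrite e1 eqxx in e.
  by rewrite e eq_sym oner_eq0.
apply/eqP; have /= <- := clopen_on_connected clopenA conA Aa Az.
by rewrite a1.
Qed.

(* A subcontinuum through [U] that misses the fold along [V] stays in the first
   sheet, one through [V] that misses the fold along [U] in the third. *)
Lemma fold_step_disjoint n (A A' : set (ambient T)) a b :
  A `<=` stepset n fold_step -> A' `<=` stepset n fold_step ->
  closed A -> connected A -> closed A' -> connected A' ->
  A a -> U a -> A `&` closure V = set0 ->
  A' b -> V b -> A' `&` closure U = set0 -> A `&` A' = set0.
Proof.
move=> sA sA' cA conA cA' conA' Aa Ua AV A'b Vb AU.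
have nAV z : A z -> closure V z -> False.
  by move=> u v; rewrite -[False]/(set0 z) -AV.
have nAU z : A' z -> closure U z -> False.
  by move=> u v; rewrite -[False]/(set0 z) -AU.
apply/seteqP; split=> // z [Az A'z].
(* Away from [closure V] no edge leaves sheet 0, so coordinate 0 is 0 or 1 on [A]; over [U] only
   sheet 0 is present. *)
have z0 : z.2 n 0 = 1.
  apply: (connected_coord01 cA conA _ Aa _ Az) => [w Aw|].
    have [i [j [_ _ /fold_cellP cw [t _ <-]]]] := sA _ Aw.
    case: cw => [[-> -> _]|[-> -> _]|[-> -> _]|[[_ _ /(nAV _ Aw)]//|[-> -> _ _]]];
      by rewrite ?edge_id /vertex /edge /= ?mulr0 ?addr0; auto.
  have [i [j [_ _ /fold_cellP cw [t _ <-]]]] := sA _ Aa.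
  case: cw => [[-> -> _]|[_ _ []]|[_ _ []]|[[_ _ /(nAV _ Aa)]//|[_ _ _ []]]]//.
    by rewrite edge_id.
  by left.
have z2 : z.2 n 2 = 1.
  apply: (connected_coord01 cA' conA' _ A'b _ A'z) => [w Aw|].
    have [i [j [_ _ /fold_cellP cw [t _ <-]]]] := sA' _ Aw.
    case: cw => [[-> -> _]|[-> -> _]|[-> -> _]|[[-> -> _ _]|[_ _ /(nAU _ Aw)]//]];
      by rewrite ?edge_id /vertex /edge /= ?mulr0 ?addr0; auto.
  have [i [j [_ _ /fold_cellP cw [t _ <-]]]] := sA' _ A'b.
  case: cw => [[_ _ []]|[_ _ []]|[-> -> _]|[[_ _ _ []]|[_ _ /(nAU _ A'b)]//]]//.
    by right.
  by rewrite edge_id.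
(* No vertex and no edge of a fold has coordinates 0 and 2 both equal to 1. *)
have [i [j [_ _ /fold_cellP cz [t _ ez]]]] := sA _ Az.
move: z0 z2; rewrite -ez.
case: cz => [[-> -> _]|[-> -> _]|[-> -> _]|[[-> -> _ _]|[-> -> _ _]]];
  rewrite ?edge_id /vertex /edge /= ?mulr0 ?addr0 => e1 e2;
  by first [move/eqP: e1; rewrite eq_sym oner_eq0|
            move/eqP: e2; rewrite eq_sym oner_eq0].
Qed.

End fold_step.

(** * Compactness at a finite scale *)

Section finite_scale.
Context {R : realType} {Z : pseudoMetricType R}.

(** Balls of a pseudometric structure need not be open, hence the interiors. *)
Lemma compact_finite_balls (A : set Z) (r : R) : compact A -> 0 < r ->
  exists s : seq Z, forall z, A z -> exists2 c, c \in s & (ball c r)° z.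
Proof.
move=> cA r0.
pose G := [set U : set Z | exists s : seq Z, U = \bigcup_(c in [set` s]) (ball c r)°].
have [||U V [s ->] [t ->]|z Az|U [s ->] As] := @compact_directed _ A G cA.
- by exists (\bigcup_(c in [set` [::]]) (ball c r)°), [::].
- by move=> U [s ->]; apply: bigcup_open => c _; exact: open_interior.
- exists (\bigcup_(c in [set` s ++ t]) (ball c r)°); first by exists (s ++ t).
  by move=> z [|] [c cs bz]; exists c => //=; rewrite mem_cat cs ?orbT.
- exists (\bigcup_(c in [set` [:: z]]) (ball c r)°); first by exists [:: z].
  exists z; first by rewrite /= inE.
  by apply: nbhs_singleton; apply: nbhs_interior; exact: nbhsx_ballx.
by exists s => z /As [c cs bz]; exists c.
Qed.

(** Four steps of length [r] lead from [a] through the centre to any point of the closure. *)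
Lemma closure_ball_subset (c a : Z) (r : R) : 0 < r ->
  closure (ball c r) a -> closure (ball c r) `<=` ball a (r *+ 4).
Proof.
move=> r0 /(_ _ (nbhsx_ballx a r r0)) [v [cv av]].
move=> z /(_ _ (nbhsx_ballx z r r0)) [w [cw zw]].
rewrite (_ : r *+ 4 = r + r + (r + r)); last by rewrite -mulr2n -mulr2n -mulrnA.
by apply: ball_triangle (ball_triangle av (ball_sym cv))
  (ball_triangle cw (ball_sym zw)).
Qed.

(** The points for which radius [e] works form a set that grows as [e] decreases; the interiors are
    a directed cover of [A]. *)
Lemma lebesgue_number (A : set Z) (I : Type) (O : I -> set Z) : compact A ->
  (forall i, open (O i)) -> A `<=` \bigcup_i O i ->
  exists2 e : R, 0 < e & forall z, A z -> exists i, ball z e `<=` O i.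
Proof.
move=> cA oO AO.
pose S e := [set z : Z | exists i, ball z e `<=` O i].
pose G := [set U : set Z | exists2 e : R, 0 < e & U = (S e)°].
have SS e d : d <= e -> S e `<=` S d.
  by move=> de z [i zO]; exists i; apply: subset_trans zO; exact: le_ball.
have [|U [e _ ->]|U V [e e0 ->] [d d0 ->]|z Az|U [e e0 ->] As] :=
    @compact_directed _ A G cA.
- by exists (S 1)°, 1.
- exact: open_interior.
- exists (S (Num.min e d))°; first by exists (Num.min e d); rewrite // lt_min e0.
  by move=> z [|]; apply: interiorS; apply: SS; rewrite ge_min lexx ?orbT.
- have [i _ Oz] := AO _ Az.
  have /nbhs_ballP[e /= e0 zO] := open_nbhs_nbhs (conj (oO i) Oz).
  exists (S (e / 2))°; first by exists (e / 2) => //; rewrite divr_gt0.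
  apply: filterS (nbhsx_ballx z (e / 2) _); last by rewrite divr_gt0.
  by move=> w zw; exists i => y wy; apply: zO; exact: ball_split zw wy.
by exists e => // z /As /interior_subset.
Qed.

End finite_scale.

(** With this value a ball of scale [m] ignores the blocks from [m.+1] on. *)
Definition radius {R : realType} (m : nat) : R := m.+1%:R^-1.

Lemma radius_gt0 (R : realType) m : 0 < radius m :> R.
Proof. by rewrite invr_gt0. Qed.

Lemma radius_small (R : realType) (e : R) : 0 < e -> exists m, radius m <= e.
Proof.
move=> e0; exists (Num.truncn e^-1).
rewrite /radius -[leRHS]invrK lef_pV2 ?posrE ?invr_gt0//.
by rewrite ltW// truncnS_gt.
Qed.

(** * The schedule of steps and the properties of its limit *)

Section schedule.
Context {R : realType} {T : pseudoMetricType R}.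
Variables (B : set T) (z0 : ambient T) (centers : nat -> seq (ambient T)).
Hypothesis centersP : forall m z, box B z ->
  exists2 c, c \in centers m & (ball c (radius m))° z.

Definition cell_ball m i : set (ambient T) := ball (nth z0 (centers m) i) (radius m).

(** [inl] asks for a fold between two balls of one scale, [inr] for the cover at one scale. *)
Definition task : Type := (nat * (nat * nat) + nat)%type.
HB.instance Definition _ := Countable.copy task (nat * (nat * nat) + nat)%type.

Definition idle_step : step T := cover_step 1 (fun=> setT).

Definition task_step (d : task) : step T :=
  match d with
  | inl (m, (i, j)) =>
      if `[< closure (cell_ball m i)° `&` closure (cell_ball m j)° = set0 >]
      then fold_step (cell_ball m i)° (cell_ball m j)° else idle_step
  | inr m => cover_step (size (centers m)) (fun i => closure (cell_ball m i))
  end.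

Definition task_scale (d : task) := match d with inl (m, _) => m | inr m => m end.

(* Every task is scheduled infinitely often; it is carried out once enough
   blocks are available. *)
Definition schedule n : step T :=
  if unpickle (logn 2 n) is Some d then
    if (task_scale d < n)%N then task_step d else idle_step
  else idle_step.

Lemma schedule_task (d : task) : exists n, schedule n = task_step d.
Proof.
(* The 2-adic valuation of [n] codes the task, and the odd cofactor pushes [n] beyond its scale. *)
pose n := (2 ^ pickle d * (task_scale d).*2.+1)%N.
have ln : logn 2 n = pickle d.
  rewrite lognM ?expn_gt0// lognX logn_prime//= muln1.
  by rewrite lognE /= dvdn2 /= odd_double addn0.
exists n; rewrite /schedule ln pickleK ifT//.
rewrite /n; apply: (@leq_trans (task_scale d).*2.+1).
  by rewrite ltnS -addnn leq_addr.
by rewrite leq_pmull// expn_gt0.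
Qed.

Lemma idle_step_valid n : valid_step B n idle_step.
Proof.
apply: cover_step_valid => [i|i|z _]; first exact: closedT.
  by [].
by exists 0%N.
Qed.

Lemma cell_ball_indep m i n : (m < n)%N -> indep n (cell_ball m i).
Proof.
move=> mn; apply: indep_ball; first exact: radius_gt0.
by rewrite /radius ler_pdivlMr// mul1r ler_nat.
Qed.

Lemma schedule_valid n : valid_step B n (schedule n).
Proof.
rewrite /schedule; case: unpickle => [[[m [i j]]|m]|]; last exact: idle_step_valid.
  rewrite /=; case: ifPn => [mn|_]; last exact: idle_step_valid.
  case: asboolP => [UV|_]; last exact: idle_step_valid.
  apply: fold_step_valid => //; try exact: open_interior;
    by apply: indep_interior; exact: cell_ball_indep.
rewrite /=; case: ifPn => [mn|_]; last exact: idle_step_valid.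
apply: cover_step_valid => [i|i|z bz].
- exact: closed_closure.
- by apply: indep_closure; exact: cell_ball_indep.
have [c cs bc] := centersP m bz; exists (index c (centers m)).
  by rewrite index_mem.
apply: subset_closure; apply: interior_subset.
by rewrite /cell_ball nth_index.
Qed.

(** The fold between small balls near [a] and [b] has been scheduled; [A] avoids the closure of the
    ball near [b], and [A'] that of the ball near [a], so this fold keeps them apart. *)
Lemma limit_disjoint (A A' : set (ambient T)) a b :
  A `<=` limit schedule B -> A' `<=` limit schedule B ->
  closed A -> connected A -> closed A' -> connected A' ->
  A a -> ~ A' a -> A' b -> ~ A b -> A `&` A' = set0.
Proof.
move=> sA sA' cA conA cA' conA' Aa nA'a A'b nAb.
have [e e0 ae] : exists2 e : R, 0 < e & ball a e `&` A' = set0.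
  have /nbhs_ballP[e e0 ae] : nbhs a (~` A').
    by apply: open_nbhs_nbhs; split=> //; exact: closed_openC.
  by exists e => //; apply/disjoints_subset.
have [d d0 bd] : exists2 d : R, 0 < d & ball b d `&` A = set0.
  have /nbhs_ballP[d d0 bd] : nbhs b (~` A).
    by apply: open_nbhs_nbhs; split=> //; exact: closed_openC.
  by exists d => //; apply/disjoints_subset.
(* Each closure lies within [4 r] of its point; a common point would bring [b] within [8 r <= e] of
   [a]. *)
have ed0 : 0 < Num.min (e / 8) (d / 8) by rewrite lt_min !divr_gt0.
have [m] := radius_small ed0.
rewrite le_min => /andP[me md]; set r : R := radius m in me md.
have r0 : 0 < r by exact: radius_gt0.
have r8e : r *+ 4 + r *+ 4 <= e by lra.
have r4e : r *+ 4 <= e by lra.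
have r4d : r *+ 4 <= d by lra.
have ex z : limit schedule B z -> exists i, (cell_ball m i)° z.
  move=> [bz _]; have [c cs bc] := centersP m bz; exists (index c (centers m)).
  by rewrite /cell_ball nth_index.
have [i Ui] := ex _ (sA _ Aa); have [j Uj] := ex _ (sA' _ A'b).
have Uia : closure (cell_ball m i)° `<=` ball a (r *+ 4).
  move=> z /(closureS (@interior_subset _ _)); apply: closure_ball_subset => //.
  exact: subset_closure (interior_subset Ui).
have Ujb : closure (cell_ball m j)° `<=` ball b (r *+ 4).
  move=> z /(closureS (@interior_subset _ _)); apply: closure_ball_subset => //.
  exact: subset_closure (interior_subset Uj).
have UV : closure (cell_ball m i)° `&` closure (cell_ball m j)° = set0.
  apply/seteqP; split=> // z [/Uia az /Ujb bz].
  suff : (ball a e `&` A') b by rewrite ae.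
  by split=> //; apply: (le_ball r8e); exact: ball_triangle az (ball_sym bz).
have [n sn] := schedule_task (inl (m, (i, j))).
have {}sn : schedule n = fold_step (cell_ball m i)° (cell_ball m j)°.
  by rewrite sn /=; case: asboolP.
have stepE (S : set (ambient T)) : S `<=` limit schedule B ->
    S `<=` stepset n (fold_step (cell_ball m i)° (cell_ball m j)°).
  by move=> SL z /SL [_ /(_ n)]; rewrite sn.
have AV : A `&` closure (cell_ball m j)° = set0.
  apply/seteqP; split=> // z [Az /Ujb bz].
  by rewrite -bd; split; [exact: (le_ball r4d bz)|exact: Az].
have A'U : A' `&` closure (cell_ball m i)° = set0.
  apply/seteqP; split=> // z [Az /Uia bz].
  by rewrite -ae; split; [exact: (le_ball r4e bz)|exact: Az].
exact: (fold_step_disjoint (stepE _ sA) (stepE _ sA') cA conA cA' conA'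
  Aa Ui AV A'b Uj A'U).
Qed.

(** Take the cover task at a scale [r] with [4 r] at most a Lebesgue number: the closure of a ball
    lies within [4 r] of any point where it meets [M]. *)
Lemma limit_refine (M : set (ambient T)) (I : Type) (O : I -> set (ambient T)) :
  M `<=` limit schedule B -> compact M -> (forall i, open (O i)) ->
  M `<=` \bigcup_i O i ->
  exists n k F, M `<=` stepset n (cover_step k F) /\
    forall l z, M z -> F l z -> exists i, F l `<=` O i.
Proof.
move=> ML cM oO MO; have [e e0 eO] := lebesgue_number cM oO MO.
have [m me] := @radius_small R (e / 4) (divr_gt0 e0 (ltr0Sn _ _)).
have r0 := radius_gt0 R m; set r : R := radius m in me r0.
have r4e : r *+ 4 <= e by lra.
have [n sn] := schedule_task (inr m).
exists n, (size (centers m)), (fun i => closure (cell_ball m i)); split.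
  by move=> z /ML [_ /(_ n)]; rewrite sn.
move=> l z Mz Fz; have [i zO] := eO _ Mz; exists i.
apply: subset_trans zO; apply: subset_trans (le_ball r4e).
exact: closure_ball_subset.
Qed.

End schedule.

(** * Subspaces as types *)

Section subtype.
Context {R : realType} {Z : pseudoMetricType R} (M : set Z).

Definition subtype := initial_topology (val : {z : Z | z \in M} -> Z).
HB.instance Definition _ := PseudoMetric.copy subtype
  (initial_topology (val : {z : Z | z \in M} -> Z)).

Definition incl (y : subtype) : Z := val y.

Lemma inclP y : M (incl y).
Proof. by have := valP y; rewrite inE. Qed.

Lemma incl_surj z : M z -> exists y, incl y = z.
Proof. by move=> Mz; exists (exist _ z (mem_set Mz)). Qed.

Lemma incl_inj : injective incl.
Proof. exact: val_inj. Qed.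

Lemma incl_continuous : continuous incl.
Proof. exact: initial_continuous. Qed.

Lemma subtype_open (U : set subtype) : open U ->
  exists2 Q, open Q & U = incl @^-1` Q.
Proof. by case=> Q oQ <-; exists Q. Qed.

Lemma subtype_closed (C : set subtype) : closed C ->
  exists2 D, closed D & C = incl @^-1` D.
Proof.
move=> /closed_openC /subtype_open [Q oQ CO]; exists (~` Q).
  exact: open_closedC.
by rewrite -[C]setCK CO.
Qed.

Lemma subtype_hausdorff : hausdorff_space Z -> hausdorff_space subtype.
Proof.
move=> hZ p q pq; apply: incl_inj; apply: hZ.
exact: cluster_continuous incl_continuous pq.
Qed.

Lemma incl_continuum (K : set subtype) :
  is_continuum K -> is_continuum (incl @` K).
Proof.
move=> [[y Ky] [cK conK]]; split; first by exists (incl y), y.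
have cincl : {within K, continuous incl}.
  by apply: continuous_subspaceT; exact: incl_continuous.
split; first exact: continuous_compact.
exact: connected_continuous_connected.
Qed.

Lemma incl_preimage (K : set Z) : K `<=` M -> incl @` (incl @^-1` K) = K.
Proof.
move=> KM; apply/seteqP; split=> [_ [y Ky <-]//|z Kz].
by have [y yz] := incl_surj (KM _ Kz); exists y => //=; rewrite yz.
Qed.

Lemma preimage_continuum (K : set Z) : K `<=` M -> is_continuum K ->
  is_continuum (incl @^-1` K).
Proof.
move=> KM [[z Kz] [cK conK]]; split.
  by have [y yz] := incl_surj (KM _ Kz); exists y; rewrite /= yz.
split.
  move=> F FF FK.
  have [w [Kw clw]] := cK (incl @ F) _ FK.
  have [y yw] := incl_surj (KM _ Kw); exists y; split; first by rewrite /= yw.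
  move=> A U FA; rewrite nbhsE => -[V [/subtype_open [Q oQ VO] Vy] VU].
  have FA' : F (incl @^-1` (incl @` A)) by apply: filterS FA => x Ax; exists x.
  have Qw : nbhs w Q.
    by apply: open_nbhs_nbhs; split=> //; move: Vy; rewrite VO /= yw.
  have [_ [[x Ax <-] Qx]] := clw _ _ FA' Qw.
  by exists x; split=> //; apply: VU; rewrite VO.
move=> S [y Sy] [C /subtype_open [Q oQ ->] SC] [D /subtype_closed [E cE ->] SE].
(* The image of a relatively clopen set is relatively clopen in [K]. *)
have im : incl @` S = K.
  apply: conK; first by exists (incl y), y.
    exists Q => //; rewrite SC; apply/seteqP; split=> [_ [x [Kx Ox] <-]//|x [Kx Ox]].
    by have [t tx] := incl_surj (KM _ Kx); exists t => //; split; rewrite /= tx.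
  exists E => //; rewrite SE; apply/seteqP; split=> [_ [x [Kx Ox] <-]//|x [Kx Ox]].
  by have [t tx] := incl_surj (KM _ Kx); exists t => //; split; rewrite /= tx.
apply/seteqP; split=> x; first by rewrite SC => -[].
by rewrite -im => -[t St /incl_inj <-].
Qed.

End subtype.

(** * Dimension zero and products of connected sets *)

(** Refine the cover by the complements of [a] and [b]. Order one makes the members disjoint, so the
    member at [a] is clopen, hence the whole space, yet it misses [a] or [b]. *)
Lemma covdim_le0_connected (Y : topologicalType) (a b : Y) :
  hausdorff_space Y -> connected [set: Y] -> a <> b -> ~ covdim_le Y 0.
Proof.
move=> hY conY ab dim0.
have cl1 (y : Y) : closed [set y].
  by apply: compact_closed => //; exact: compact_set1.
pose U (i : 'I_2) := if i == ord0 then ~` [set a] else ~` [set b].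
have [i|y|k [V [oV covV VU ordV]]] := dim0 2%N U.
- by rewrite /U; case: ifP => _; exact: closed_openC.
- have [->|ya] := pselect (y = a); first by exists ord_max => /= /ab.
  by exists ord0.
have [j Vj] := covV a.
have uniqV y j1 j2 : V j1 y -> V j2 y -> j1 = j2.
  move=> v1 v2; have /card_le1_eqP := ordV y; apply; rewrite inE; exact/asboolP.
have VT : V j = [set: Y].
  apply: conY; first by exists a.
    by exists (V j) => //; rewrite setTI.
  exists (V j); last by rewrite setTI.
  rewrite -[V j]setCK; apply: open_closedC.
  rewrite (_ : ~` V j = \bigcup_(l in [set l | l != j]) V l).
    by apply: bigcup_open => l _; exact: oV.
  apply/seteqP; split=> y.
    move=> nV; have [l Vl] := covV y; exists l => //=.
    by apply/eqP => lj; apply: nV; rewrite -lj.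
  by move=> [l /= /eqP lj Vl] Vjy; apply: lj; exact: uniqV Vl Vjy.
have [i ViU] := VU j.
move: ViU; rewrite VT /U; case: ifP => _ sub.
  by have := sub a I; apply.
by have := sub b I; apply.
Qed.

Lemma pair_cst_continuous (S T : topologicalType) (t : T) :
  continuous (fun s : S => (s, t)).
Proof. by move=> s; apply: cvg_pair; [exact: cvg_id|exact: cvg_cst]. Qed.

Lemma connected_setX (S T : topologicalType) (A : set S) (B : set T) :
  connected A -> connected B -> connected (A `*` B).
Proof.
move=> cA cB.
have [B0|/set0P[b Bb]] := eqVneq B set0.
  by rewrite B0 setX0; exact: connected0.
have hor t : connected (A `*` [set t]).
  rewrite (_ : _ `*` _ = (fun s => (s, t)) @` A).
    apply: connected_continuous_connected => //; apply: continuous_subspaceT.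
    exact: pair_cst_continuous.
  by apply/seteqP; split=> [[s u] [/= As ->]|_ [s As <-]] //; exists s.
have ver s : connected ([set s] `*` B).
  rewrite (_ : _ `*` _ = (fun t => (s, t)) @` B).
    apply: connected_continuous_connected => //; apply: continuous_subspaceT => t.
    by apply: cvg_pair; [exact: cvg_cst|exact: cvg_id].
  by apply/seteqP; split=> [[u t] [/= -> Bt]|_ [t Bt <-]] //; exists t.
have [A0|/set0P[a Aa]] := eqVneq A set0.
  by rewrite A0 set0X; exact: connected0.
rewrite (_ : A `*` B =
    \bigcup_(s in A) (([set s] `*` B) `|` (A `*` [set b]))).
  apply: bigcup_connected; first by exists (a, b) => s As; right.
  by move=> s As; apply: connectedU => //; exists (s, b).
apply/seteqP; split=> [[s t] [/= As Bt]|[s t] [u Au [|] [/= h1 h2]]].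
- by exists s => //; left.
- by rewrite h1.
- by rewrite h2.
Qed.

(** * The hereditarily indecomposable continuum over a given base *)

Section tower_space.
Context {R : realType} {T : pseudoMetricType R}.
Variable B : set T.
Hypothesis hT : hausdorff_space T.
Hypothesis BC : is_continuum B.

Lemma hi_lift : exists (Y : pseudoMetricType R) (p : Y -> T),
  [/\ hausdorff_space Y, is_continuum [set: Y], covdim_le Y 1,
      hereditarily_indecomposable Y & continuous p] /\
  forall K, is_continuum K -> K `<=` B ->
    exists K', is_continuum K' /\ p @` K' = K.
Proof.
have [[x0 Bx0] [cB _]] := BC.
have /choice[centers centersP] : forall m, exists c : seq (ambient T),
    forall z, box B z -> exists2 x, x \in c & (ball x (radius m))° z.
  move=> m; apply: compact_finite_balls; first exact: box_compact.
  exact: radius_gt0.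
pose s := schedule (base x0) centers.
have [M [ML MC MK]] := tower_continuum hT cB (schedule_valid (base x0) centersP) BC.
have cM : compact M by case: MC => _ [].
have hZ : hausdorff_space (ambient T) by exact: ambient_hausdorff.
exists (subtype M), (fun y : subtype M => (incl y : ambient T).1); split.
  split.
  - exact: subtype_hausdorff.
  - rewrite (_ : setT = @incl _ _ M @^-1` M); first exact: preimage_continuum.
    by apply/seteqP; split=> y // _; exact: inclP.
  - move=> k U oU covU.
    have /choice[Q OP] : forall i, exists Q : set (ambient T),
        open Q /\ U i = @incl _ _ M @^-1` Q.
      by move=> i; have [Q oQ UQ] := subtype_open (oU i); exists Q.
    have MO : M `<=` \bigcup_i Q i.
      move=> z Mz; have [y yz] := incl_surj Mz; have [i Ui] := covU y.
      by exists i => //; move: Ui; have [_ ->] := OP i; rewrite /= yz.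
    have [n [m [F [MS FO]]]] :=
      limit_refine ML cM (fun i => (OP i).1) MO.
    pose W (j : 'I_m) : set (subtype M) := [set y | 0 < (incl y : ambient T).2 n j].
    exists m, W; split.
    + move=> j; rewrite (_ : W j = (fun y => (incl y : ambient T).2 n j) @^-1` [set x | 0 < x])//.
      apply: open_comp; last exact: open_gt.
      move=> y _; apply: (@continuous_comp _ _ _ (@incl _ _ M)
        (fun z : ambient T => z.2 n j)); first exact: incl_continuous.
      exact: coord_continuous.
    + move=> y; have [i [j [im jm _ _ h]]] := cover_step_star (MS _ (inclP y)).
      by case: h => h; [exists (Ordinal im)|exists (Ordinal jm)].
    + move=> j; have [W0|/set0P[y Wy]] := eqVneq (W j) set0.
        (* An empty star lies in any member of the cover, and one exists because [M] is nonempty. *)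
        have [[z Mz] _] := MC; have [i _ _] := MO _ Mz.
        by exists i; rewrite W0.
      have WF y' : W j y' -> F j (incl y').
        move=> Wy'; have [a [b [_ _ [Fa Fb] h _]]] := cover_step_star (MS _ (inclP y')).
        by have [->|->] := h _ Wy'.
      have [i FOi] := FO j _ (inclP y) (WF _ Wy).
      by exists i => y' Wy'; have [_ ->] := OP i; apply: FOi; exact: WF.
    + move=> y; have [a [b [am bm _ h _]]] := cover_step_star (MS _ (inclP y)).
      apply: (@leq_trans #|[set Ordinal am; Ordinal bm]%SET|); last first.
        by rewrite cards2; case: (_ != _).
      apply/subset_leq_card/fintype.subsetP => j; rewrite inE => /asboolP Wj; rewrite !inE.
      by have [e|e] := h _ Wj; apply/orP; [left|right]; apply/eqP/val_inj.
  - move=> K KC [A [A' [AC A'C AK A'K KE]]].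
    have [a Aa nA'a] : exists2 a, A a & ~ A' a.
      apply: contrapT => h; case: A'K => _; apply; rewrite KE => y [Ay|//].
      by apply: contrapT => n; apply: h; exists y.
    have [b A'b nAb] : exists2 b, A' b & ~ A b.
      apply: contrapT => h; case: AK => _; apply; rewrite KE => y [//|Ay].
      by apply: contrapT => n; apply: h; exists y.
    have [_ [cA conA]] := incl_continuum AC.
    have [_ [cA' conA']] := incl_continuum A'C.
    have sub (S : set (subtype M)) : @incl _ _ M @` S `<=` limit s B.
      by move=> _ [y _ <-]; apply: ML; exact: inclP.
    have nincl (S : set (subtype M)) y : ~ S y -> ~ (@incl _ _ M @` S) (incl y).
      by move=> nS [y' Sy' /incl_inj e]; apply: nS; rewrite -e.
    (* Each piece has a point outside the other, so they are disjoint; then [A] is clopen in the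
       connected [K]. *)
    have AA' : @incl _ _ M @` A `&` @incl _ _ M @` A' = set0.
      apply: (limit_disjoint centersP (sub A) (sub A') _ conA _ conA'
        (imageP _ Aa) (nincl _ _ nA'a) (imageP _ A'b) (nincl _ _ nAb));
        exact: compact_closed.
    have clC (S : set (subtype M)) : is_continuum S -> closed S.
      move=> [_ [cS _]]; apply: compact_closed cS; exact: subtype_hausdorff.
    have [_ [_ conK]] := KC.
    apply: nAb; rewrite (_ : A = K); first by rewrite KE; right.
    apply: conK; first by exists a.
      exists (~` A'); first by apply: closed_openC; exact: clC.
      rewrite KE; apply/seteqP; split=> y.
        move=> Ay; split; first by left.
        move=> A'y; suff : (@incl _ _ M @` A `&` @incl _ _ M @` A') (incl y).
          by rewrite AA'.
        by split; exists y.
      by move=> [[]].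
    exists A; first exact: clC.
    by rewrite KE; apply/seteqP; split=> y; [move=> Ay; split=> //; left|case].
  - move=> y; apply: (@continuous_comp _ _ _ (@incl _ _ M) (fun z : ambient T => z.1)).
      exact: incl_continuous.
    exact: fst_ambient_continuous.
move=> K KC KB; have [M' [M'M M'C <-]] := MK _ KC KB.
exists (@incl _ _ M @^-1` M'); split; first exact: preimage_continuum.
by rewrite -[in RHS](incl_preimage M'M) -image_comp.
Qed.

End tower_space.

Theorem theorem2p1 (R : realType) (X : pseudoMetricType R)
  (hX : hausdorff_space X) (cX : is_continuum [set: X]) :
  exists (Y : pseudoMetricType R) (pi : Y -> X),
    [/\ hausdorff_space Y, is_continuum [set: Y],
        covdim_eq1 Y & hereditarily_indecomposable Y] /\
    [/\ continuous pi, pi @` [set: Y] = [set: X] & weakly_confluent pi].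
Proof.
pose B : set (X * R)%type := [set: X] `*` `[0, 1]%classic.
have [[x0 _] [compX conX]] := cX.
have in0 : `[0, 1]%classic (0 : R) by rewrite /= in_itv /= lexx ler01.
have in1 : `[0, 1]%classic (1 : R) by rewrite /= in_itv /= lexx ler01.
have BC : is_continuum B.
  split; first by exists (x0, 0); split.
  split; first by apply: compact_setX => //; exact: segment_compact.
  by apply: connected_setX => //; exact: segment_connected.
have hT : hausdorff_space (X * R)%type.
  by apply: prod_hausdorff => //; exact: Rhausdorff.
have [Y [p [[hY YC dimY hiY cp] lift]]] := hi_lift hT BC.
have wc : weakly_confluent (fun y => (p y).1).
  move=> K [[x Kx] [cK conK]].
  have cin : {within K, continuous (fun x : X => (x, 0 : R))}.
    by apply: continuous_subspaceT; exact: pair_cst_continuous.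
  (* [K] is lifted through its copy at height 0. *)
  have [|_ [t _ <-]|K' [K'C pK']] := lift ((fun x : X => (x, 0 : R)) @` K).
  - split; first by exists (x, 0), x.
    split; first exact: continuous_compact.
    exact: connected_continuous_connected.
  - by split.
  exists K'; split=> //; rewrite -(image_comp p fst K') pK'.
  by apply/seteqP; split=> [_ [_ [t Kt <-] <-]//|t Kt]; exists (t, 0) => //; exists t.
exists Y, (fun y => (p y).1); split; split=> //.
- split=> //.
  (* Points over heights 0 and 1 differ, which excludes dimension 0. *)
  have [K' [_ pK']] := lift B BC (@subset_refl _ B).
  have [a _ pa] : (p @` K') (x0, 0) by rewrite pK'; split.
  have [b _ pb] : (p @` K') (x0, 1) by rewrite pK'; split.
  apply: (@covdim_le0_connected _ a b) => //; first by case: YC => _ [].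
  move=> ab; have := oner_neq0 R; rewrite -[1]/((x0, 1 : R).2) -pb -ab pa.
  by rewrite eqxx.
- move=> y; apply: (@continuous_comp _ _ _ p fst); first exact: cp.
  exact: cvg_fst.
- have [K' [_ e]] := wc _ cX; apply/seteqP; split=> // x _.
  have [y _ <-] : ((fun y => (p y).1) @` K') x by rewrite e.
  by exists y.
Qed.
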